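(* Let $\ell\ge1$ and let $\lambda=(\lambda_1,\ldots,\lambda_\ell)$ be a generalized partition of length $\ell$ (a non-increasing sequence of integers). Then $$\sum_\mu q^{\frac{\mu^2}{2}}K^{(-1)}_{\mu\lambda}=q^{\frac{\lambda^2}{2}}\prod_{1\le i<j\le\ell}\big(1-q^{\lambda_i-\lambda_j+j-i}\big),$$ where the summation is over generalized partitions $\mu$ of length $\ell$ of the same size as $\lambda$, i.e. $|\mu|=|\lambda|$.
   Context: Here $q$ is a formal parameter. For a generalized partition $\lambda=(\lambda_1\ge\cdots\ge\lambda_\ell)$, $\lambda_i\in\mathbb Z$, put $|\lambda|=\sum_i\lambda_i$ and $\lambda^2=\sum_i\lambda_i^2$. $m_\lambda(z_1,\ldots,z_\ell)$ is the monomial symmetric Laurent polynomial (sum of the distinct permutations of $z_1^{\lambda_1}\cdots z_\ell^{\lambda_\ell}$) and $s_\lambda(z_1,\ldots,z_\ell)$ is the Schur Laurent polynomial, i.e. $s_\lambda=(z_1\cdots z_\ell)^{-r}s_{(\lambda_1+r,\ldots,\lambda_\ell+r)}$ for any integer $r$ with $\lambda_\ell+r\ge0$, where the right-hand side uses the usual Schur polynomial in $\ell$ variables. Both families, over all generalized partitions of length $\ell$, are bases of $\mathbb C[z_1^{\pm1},\ldots,z_\ell^{\pm1}]^{S_\ell}$. The Kostka numbers $K_{\lambda\mu}$ are defined by $s_\lambda=\sum_\mu K_{\lambda\mu}m_\mu$, and the inverse Kostka matrix by $m_\mu=\sum_\lambda K^{(-1)}_{\mu\lambda}s_\lambda$ (sums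 over generalized partitions of length $\ell$). *)

(* Defs.v *)
From HB Require Import structures.
From mathcomp Require Import all_boot all_order all_algebra.
From mathcomp Require Import finmap mpoly fraction.
From mathcomp Require Import boolp classical_sets fsbigop.

Set Implicit Arguments.
Unset Strict Implicit.
Unset Printing Implicit Defensive.

Import Order.TTheory GRing.Theory Num.Theory.
Local Open Scope ring_scope.

Record genpart (l : nat) := GenPart {
  gpval :> l.-tuple int;
  _ : sorted >=%R gpval }.

HB.instance Definition _ l := [isSub for @gpval l].
HB.instance Definition _ l := [Choice of genpart l by <:].

Definition gpsize l (la : genpart l) : int := \sum_(i < l) tnth la i.

Definition gpsqr l (la : genpart l) : nat := (\sum_(i < l) `|tnth la i| ^ 2)%N.

(* C[z_1^{+-1}, ..., z_l^{+-1}] is handled as a subring of the field of         *)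
(* rational functions C(z_1, ..., z_l), in which negative powers make sense.   *)
Section LaurentPolynomials.
Variables (F : fieldType) (l : nat).

Definition ratfun : fieldType := {fraction {mpoly F[l]}}.

Definition zvar (i : 'I_l) : ratfun := tofrac ('X_i : {mpoly F[l]}).

Definition zconst (c : F) : ratfun := tofrac (c%:MP : {mpoly F[l]}).

(* [permutations] is duplicate-free, so each distinct monomial occurs once.    *)
Definition monomial_sym (mu : genpart l) : ratfun :=
  \sum_(a <- permutations mu) \prod_(i < l) zvar i ^ (a`_i).

Definition alternant (e : 'I_l -> nat) : ratfun :=
  \det (\matrix_(i < l, j < l) zvar i ^+ e j).

(* The Schur polynomial of the partition p_0 >= ... >= p_{l-1} >= 0, as a ratio *)
(* of alternants.                                                              *)
Definition schur_poly (p : 'I_l -> nat) : ratfun :=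
  alternant (fun j => p j + (l - j.+1))%N / alternant (fun j => l - j.+1)%N.

(* The shift is r = |la_l|; the value is the same for every r with             *)
(* 0 <= la_l + r, see [schurE].                                                *)
Definition schur (la : genpart l) : ratfun :=
  let r := `|last (0 : int) la|%N in
  (\prod_(i < l) zvar i) ^- r * schur_poly (fun j => `|(tnth la j + r%:Z)%R|%N).

(* c is the row of coefficients of the expansion of m_mu in the basis of the   *)
(* s_la.                                                                       *)
Definition schur_expansion (mu : genpart l)
    (c : {fsfun genpart l -> F with 0}) : Prop :=
  monomial_sym mu = \sum_(la <- finsupp c) zconst (c la) * schur la.

(* The expansion exists and is unique, because the s_la form a basis.          *)
Definition inv_kostka (mu la : genpart l) : F :=
  xget [fsfun] [set c | schur_expansion mu c]%classic la.

End LaurentPolynomials.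

Section SchurShift.
Variables (F : fieldType) (l : nat).

Lemma zvar_neq0 (i : 'I_l) : zvar F i != 0.
Proof.
rewrite /zvar tofrac_eq0; apply/negP => /eqP /(congr1 (mcoeff U_(i))).
by rewrite mcoeffX eqxx mcoeff0 => /eqP; rewrite oner_eq0.
Qed.

Lemma genpart_last_le (la : genpart l) (j : 'I_l) : last (0 : int) la <= tnth la j.
Proof.
case: la => t st /=; case: l t st j => [|n] t st j; first by case: j.
rewrite (tnth_nth 0) -nth_last size_tuple /=.
have ge_trans : transitive (>=%R : rel int).
  by move=> x y z /= h1 h2; apply: le_trans h2 h1.
have ge_refl : reflexive (>=%R : rel int) by move=> x /=.
apply: (sorted_leq_nth ge_trans ge_refl 0 st).
- by rewrite inE size_tuple.
- by rewrite inE size_tuple.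
- by rewrite -ltnS.
Qed.

Lemma schur_shiftE (la : genpart l) (r : nat) : 0 <= last (0 : int) la + r%:Z ->
  (\prod_(i < l) zvar F i) ^- r * schur_poly F (fun j => `|(tnth la j + r%:Z)%R|%N)
  = \det (\matrix_(i < l, j < l) zvar F i ^ (tnth la j + (l - j.+1)%N%:Z))
    / alternant F (fun j : 'I_l => l - j.+1)%N.
Proof.
move=> hr; rewrite /schur_poly mulrA; congr (_ / _).
have -> : alternant F (fun j : 'I_l => `|(tnth la j + r%:Z)%R|%N + (l - j.+1))%N
  = \det (diag_mx (\row_(i < l) zvar F i ^+ r) *m
     \matrix_(i < l, j < l) zvar F i ^ (tnth la j + (l - j.+1)%N%:Z)).
  congr (\det _); apply/matrixP => i j; rewrite mul_diag_mx !mxE.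
  rewrite !exprnP -expfzDr ?zvar_neq0 //; congr (_ ^ _).
  rewrite PoszD gez0_abs; last first.
    by apply: le_trans hr _; rewrite lerD2r genpart_last_le.
  by rewrite -addrA addrCA.
rewrite det_mulmx det_diag mulrA.
have -> : \prod_(i < l) (\row_(i < l) zvar F i ^+ r) 0 i
  = \prod_(i < l) zvar F i ^+ r by apply: eq_bigr => i _; rewrite mxE.
rewrite prodrXl mulVf ?mul1r // expf_neq0 //.
by apply/prodf_neq0 => i _; apply: zvar_neq0.
Qed.

Lemma schurE (la : genpart l) (r : nat) : 0 <= last (0 : int) la + r%:Z ->
  schur F la = (\prod_(i < l) zvar F i) ^- r
    * schur_poly F (fun j => `|(tnth la j + r%:Z)%R|%N).
Proof.
move=> hr; rewrite /schur !schur_shiftE //.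
by rewrite -lerBlDl sub0r (le_trans (ler_norm _)) // normrN abszE.
Qed.

End SchurShift.

(* The formal variable is the square root of q, so that q^{n/2} is 'X^n.       *)
Section FormalParameter.
Variable F : fieldType.

Definition sqrtq : {poly F} := 'X.

Definition q : {poly F} := sqrtq ^+ 2.

End FormalParameter.

(* Main.v *)
Require Import Defs.
From mathcomp Require Import all_boot all_order all_algebra all_fingroup.
From mathcomp Require Import finmap mpoly fraction complex.
From mathcomp Require Import boolp classical_sets fsbigop reals.
From mathcomp Require Import ring zify.

(** Write rho = (0, -1, ..., -(l-1)) and let a_e = sum_s sgn(s) z^(s(e)) be the
    alternant with exponents e, so that s_la = a_(la+rho) / a_rho.  Multiplied by
    a_rho, the expansion of m_mu in Schur polynomials becomes
      m_mu a_rho = sum_la K^(-1)_(mu,la) a_(la+rho).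
    The monomial z^(la+rho) occurs only in the alternant of la, with coefficient
    1, so K^(-1)_(mu,la) is its coefficient in m_mu a_rho:
      K^(-1)_(mu,la) = sum_s sgn(s) [(la + rho) - s(rho) is a permutation of mu]
    ([inv_kostkaE]).  Existence of the expansion comes from writing m_mu a_rho as
    the sum of the a_(a+rho) over the orbit of mu ([monomial_sym_antisym]), each
    of which is zero or plus or minus some a_(la+rho) ([antisym_straighten]).

    Each permutation s thus contributes to exactly one mu.  This mu has the size
    of la, and mu^2 is the square of the vector la + rho - s(rho), so the left
    side of the identity is sum_s sgn(s) q^((la + rho - s(rho))^2 / 2).  This is
    the determinant of the matrix q^((u_i + j)^2 / 2) with u = la + rho, and
    expanding the square makes it a Vandermonde determinant in the q^(u_i)
    ([gauss_alternating_sum]), whose factors are those of the right side. *)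

Import Order.TTheory GRing.Theory Num.Theory.
Local Open Scope ring_scope.

Set Implicit Arguments.
Unset Strict Implicit.

(** * Coefficients of Laurent polynomials *)

Section LaurentCoefficients.
Variables (F : fieldType) (l : nat).
Implicit Types (e : l.-tuple int) (f g : ratfun F l).

Definition zmon e : ratfun F l := \prod_(i < l) zvar F i ^ tnth e i.

(** The ambient ring is the field of rational functions, where a coefficient
    is not given by a formula; [has_coeffs f k] says that f is a Laurent
    polynomial with coefficients k by clearing denominators: (z_1...z_l)^N f
    is a polynomial with the shifted coefficients.  It is asked for all large
    N, so that two such f have a common N when they are added. *)
Definition has_coeffs f (k : l.-tuple int -> F) : Prop :=
  exists N0 : nat, forall N, (N0 <= N)%N ->
  exists2 P : {mpoly F[l]},
    (\prod_(i < l) zvar F i) ^+ N * f = tofrac P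
  & forall m : 'X_{1..l}, P@_m = k [tuple (m i)%:Z - N%:Z | i < l].

Lemma zmonD e e' :
  zmon [tuple tnth e i + tnth e' i | i < l] = zmon e * zmon e'.
Proof.
rewrite /zmon -big_split; apply: eq_bigr => i _ /=.
by rewrite tnth_mktuple expfzDr ?zvar_neq0.
Qed.

Lemma tofrac_monomial (m : 'X_{1..l}) :
  tofrac 'X_[m] = \prod_(i < l) zvar F i ^+ m i.
Proof.
rewrite mpolyXE_id rmorph_prod; apply: eq_bigr => i _.
by rewrite rmorphXn.
Qed.

Lemma zconstE (c : F) (P : {mpoly F[l]}) :
  zconst l c * tofrac P = tofrac (c *: P).
Proof. by rewrite -mul_mpolyC tofracM. Qed.

Lemma has_coeffs_ext f k k' : k =1 k' -> has_coeffs f k -> has_coeffs f k'.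
Proof.
move=> kk' [N0 hN0]; exists N0 => N /hN0[P fP Pk].
by exists P => // m; rewrite Pk kk'.
Qed.

Lemma has_coeffs0 : has_coeffs 0 (fun=> 0).
Proof.
exists 0%N => N _; exists 0; first by rewrite mulr0 tofrac0.
by move=> m; rewrite mcoeff0.
Qed.

Lemma has_coeffsD f g k k' : has_coeffs f k -> has_coeffs g k' ->
  has_coeffs (f + g) (fun e => k e + k' e).
Proof.
move=> [N1 h1] [N2 h2]; exists (maxn N1 N2) => N.
rewrite geq_max => /andP[/h1[P fP Pk] /h2[Q gQ Qk]]; exists (P + Q).
  by rewrite mulrDr fP gQ tofracD.
by move=> m; rewrite mcoeffD Pk Qk.
Qed.

Lemma has_coeffsZ c f k : has_coeffs f k ->
  has_coeffs (zconst l c * f) (fun e => c * k e).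
Proof.
move=> [N0 h]; exists N0 => N /h[P fP Pk]; exists (c *: P).
  by rewrite mulrCA fP zconstE.
by move=> m; rewrite mcoeffZ Pk.
Qed.

Lemma has_coeffs_sum (I : Type) (r : seq I) (p : pred I) (f : I -> ratfun F l)
    (k : I -> l.-tuple int -> F) :
  (forall i, has_coeffs (f i) (k i)) ->
  has_coeffs (\sum_(i <- r | p i) f i) (fun e => \sum_(i <- r | p i) k i e).
Proof.
move=> fk; elim: r => [|i r IHr].
  by rewrite big_nil; apply: has_coeffs_ext has_coeffs0 => e; rewrite big_nil.
rewrite big_cons; case: ifP => pi.
  by apply: has_coeffs_ext (has_coeffsD (fk i) IHr) => e; rewrite big_cons pi.
by apply: has_coeffs_ext IHr => e; rewrite big_cons pi.
Qed.

Lemma has_coeffs_zmon e : has_coeffs (zmon e) (fun e' => (e == e')%:R).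
Proof.
exists (\sum_i `|tnth e i|)%N => N leN.
have e_ge0 i : 0 <= tnth e i + N%:Z.
  have : (`|tnth e i| <= \sum_i `|tnth e i|)%N.
    by rewrite (bigD1 i) //= leq_addr.
  by lia.
exists 'X_[[multinom `|(tnth e i + N%:Z)%R|%N | i < l]].
  rewrite tofrac_monomial -prodrXl -big_split; apply: eq_bigr => i _ /=.
  by rewrite mnmE !exprnP gez0_abs // addrC expfzDr ?zvar_neq0.
move=> m; rewrite mcoeffX; congr ((nat_of_bool _)%:R); apply/eqP/eqP => [<-|->].
  apply: eq_from_tnth => i; rewrite tnth_mktuple mnmE gez0_abs //.
  by rewrite addrK.
by apply/mnmP => i; rewrite mnmE tnth_mktuple subrK.
Qed.

(** Linear independence of the Laurent monomials: once N is large enough for the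
    two coefficient functions and for the exponent e, both compute the same
    coefficient of the same polynomial. *)
Lemma has_coeffs_unique f k k' : has_coeffs f k -> has_coeffs f k' -> k =1 k'.
Proof.
move=> [N1 h1] [N2 h2] e.
pose N := (N1 + N2 + \sum_i `|tnth e i|)%N.
have leN1 : (N1 <= N)%N by rewrite /N; lia.
have leN2 : (N2 <= N)%N by rewrite /N; lia.
have [P fP Pk] := h1 N leN1.
have [Q fQ Qk] := h2 N leN2.
have PQ : P = Q by apply/eqP; rewrite -tofrac_eq -fP fQ.
have e_ge0 i : 0 <= tnth e i + N%:Z.
  have : (`|tnth e i| <= \sum_i `|tnth e i|)%N.
    by rewrite (bigD1 i) //= leq_addr.
  by rewrite /N; lia.
pose m := [multinom `|(tnth e j + N%:Z)%R|%N | j < l].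
have -> : e = [tuple (m i)%:Z - N%:Z | i < l].
  apply: eq_from_tnth => i; rewrite tnth_mktuple mnmE gez0_abs //.
  by rewrite addrK.
by rewrite -Pk -Qk PQ.
Qed.

End LaurentCoefficients.

(** * Generalized partitions and orbits of exponents *)

Section Orbits.
Variable l : nat.
Implicit Types (a e : l.-tuple int) (mu la : genpart l).

Lemma ge_trans : transitive (>=%R : rel int).
Proof. by move=> x y z /= h1 h2; apply: le_trans h2 h1. Qed.

Lemma ge_anti : antisymmetric (>=%R : rel int).
Proof. by move=> x y; rewrite andbC => /le_anti. Qed.

Lemma ge_total : total (>=%R : rel int).
Proof. by move=> x y /=; rewrite orbC le_total. Qed.

Lemma genpart_anti la (i j : 'I_l) : (i <= j)%N -> tnth la j <= tnth la i.
Proof.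
move=> ij; rewrite !(tnth_nth 0).
have ge_refl : reflexive (>=%R : rel int) by move=> x /=.
by apply: (sorted_leq_nth ge_trans ge_refl 0 (valP la)); rewrite ?inE ?size_tuple.
Qed.

Lemma tuple_sorted_ge a :
  (forall i j : 'I_l, (i < j)%N -> tnth a j <= tnth a i) -> sorted >=%R a.
Proof.
move=> anti; apply/(sortedP 0) => i; rewrite size_tuple => lti.
have := anti (Ordinal (ltnW lti)) (Ordinal lti) (ltnSn i).
by rewrite !(tnth_nth 0).
Qed.

(** The weight e + rho, for the choice rho = (0, -1, ..., -(l-1)).  This differs
    from the usual (l-1, ..., 0) by a constant vector, that is by a factor
    (z_1...z_l)^(l-1) which cancels in the ratio of alternants. *)
Definition shifted e : l.-tuple int := [tuple tnth e i - i%:Z | i < l].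

Definition rho : l.-tuple int := [tuple - i%:Z | i < l].

Lemma shifted_decr la (i j : 'I_l) : (i < j)%N ->
  tnth (shifted la) j < tnth (shifted la) i.
Proof.
by move=> ij; rewrite !tnth_mktuple; have := genpart_anti la (ltnW ij); lia.
Qed.

Lemma shifted_inj la la' : shifted la = shifted la' -> la = la'.
Proof.
move=> eq_la; apply: val_inj; apply: eq_from_tnth => i.
by have := congr1 (fun t => tnth t i) eq_la; rewrite !tnth_mktuple => /addIr.
Qed.

Lemma perm_mktuple a (s : 'S_l) : perm_eq [tuple tnth a (s i) | i < l] a.
Proof. by apply/tuple_permP; exists s. Qed.

Definition genpart_of a : genpart l :=
  @GenPart l (sort_tuple >=%R a) (sort_sorted ge_total a).

(** An S_l-orbit of exponents contains exactly one non-increasing sequence, so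
    being a rearrangement of mu is an equation between generalized
    partitions. *)
Lemma genpart_of_eq a mu : (genpart_of a == mu) = perm_eq a mu.
Proof.
apply/eqP/idP => [<-|amu]; first by rewrite perm_sym perm_sort.
apply/val_inj/val_inj/(sorted_eq ge_trans ge_anti) => /=.
- exact: sort_sorted ge_total a.
- exact: (valP mu).
- by rewrite perm_sort.
Qed.

Lemma big_genpart_of (S : Type) (idx : S) (op : Monoid.com_law idx) a
    (f : int -> S) :
  \big[op/idx]_(i < l) f (tnth (genpart_of a) i) =
  \big[op/idx]_(i < l) f (tnth a i).
Proof.
rewrite -(big_tuple _ _ _ xpredT) -[RHS](big_tuple _ _ _ xpredT).
by apply: perm_big; rewrite /= perm_sort.
Qed.

Definition rearr mu : {fset l.-tuple int} :=
  [fset a in pmap insub (permutations mu)]%fset.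

Lemma mem_rearr mu a : (a \in rearr mu) = perm_eq a mu.
Proof. by rewrite !inE mem_pmap_sub mem_permutations. Qed.

Lemma rearr_perm mu (s : 'S_l) :
  perm_eq [seq [tuple tnth a (s i) | i < l] | a <- rearr mu] (rearr mu).
Proof.
have sK (t : 'S_l) a :
    [tuple tnth [tuple tnth a ((t^-1)%g i) | i < l] (t i) | i < l] = a.
  by apply: eq_from_tnth => i; rewrite !tnth_mktuple permK.
apply: uniq_perm; rewrite ?fset_uniq //.
  rewrite map_inj_uniq ?fset_uniq // => a b eq_ab.
  by rewrite -(sK (s^-1)%g a) -(sK (s^-1)%g b) invgK eq_ab.
move=> a; rewrite mem_rearr; apply/mapP/idP => [[b + ->]|amu].
  by rewrite mem_rearr; apply: perm_trans; apply: perm_mktuple.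
exists [tuple tnth a ((s^-1)%g i) | i < l]; last by rewrite sK.
by rewrite mem_rearr (perm_trans (perm_mktuple _ _)).
Qed.

(** The weight (la + rho) - s(rho). *)
Definition rho_twist la (s : 'S_l) : l.-tuple int :=
  [tuple tnth la i - i%:Z + (s i)%:Z | i < l].

End Orbits.

(** * Alternants *)

Section Alternants.
Variables (F : fieldType) (l : nat).
Implicit Types (a e : l.-tuple int) (mu la : genpart l).

(** The alternant a_e.  It is given as an antisymmetrized monomial rather than as
    a determinant because its coefficients are read off from this form. *)
Definition antisym e : ratfun F l :=
  \sum_(s : 'S_l) (-1) ^+ s * zmon F [tuple tnth e (s i) | i < l].

Definition antisym_coeff e e' : F :=
  \sum_(s : 'S_l) (-1) ^+ s * ([tuple tnth e (s i) | i < l] == e')%:R.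

Lemma antisym_det e : antisym e = \det (\matrix_(i, j) zvar F i ^ tnth e j).
Proof.
apply: eq_bigr => s _; congr (_ * _); apply: eq_bigr => i _.
by rewrite mxE tnth_mktuple.
Qed.

Lemma alternant_antisym e :
  \det (\matrix_(i < l, j < l) zvar F i ^ (tnth e j + (l - j.+1)%N%:Z)) =
  (\prod_(i < l) zvar F i) ^+ l.-1 * antisym (shifted e).
Proof.
rewrite antisym_det -prodrXl.
have -> : \prod_(i < l) zvar F i ^+ l.-1 =
    \det (diag_mx (\row_(i < l) zvar F i ^+ l.-1)).
  by rewrite det_diag; apply: eq_bigr => i _; rewrite mxE.
rewrite -det_mulmx; congr (\det _); apply/matrixP => i j.
rewrite mul_diag_mx !mxE tnth_mktuple exprnP -expfzDr ?zvar_neq0 //.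
by congr (_ ^ _); have := ltn_ord j; lia.
Qed.

Lemma schur_antisym la : schur F la = antisym (shifted la) / antisym (rho l).
Proof.
rewrite /schur schur_shiftE; last by have := ler_norm (- last 0 la); lia.
rewrite alternant_antisym.
have -> : alternant F (fun j : 'I_l => l - j.+1)%N =
    (\prod_(i < l) zvar F i) ^+ l.-1 * antisym (rho l).
  have -> : rho l = shifted [tuple 0 | i < l].
    by apply: eq_from_tnth => i; rewrite !tnth_mktuple sub0r.
  rewrite -alternant_antisym; congr (\det _); apply/matrixP => i j.
  by rewrite !mxE tnth_mktuple add0r.
rewrite invfM mulrACA divff ?mul1r // expf_neq0 //.
by apply/prodf_neq0 => i _; apply: zvar_neq0.
Qed.

Lemma antisym_perm e (s : 'S_l) :
  antisym [tuple tnth e (s i) | i < l] = (-1) ^+ s * antisym e.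
Proof.
rewrite /antisym (reindex_inj (mulIg s^-1)%g) mulr_sumr; apply: eq_bigr => t _.
rewrite mulrA -signr_addb odd_permM odd_permV addbC; congr (_ * _).
congr (zmon _ _); apply: eq_from_tnth => i.
by rewrite !tnth_mktuple permM permKV.
Qed.

Lemma antisym_repeat e (i j : 'I_l) : i != j -> tnth e i = tnth e j ->
  antisym e = 0.
Proof.
move=> ij eij; rewrite antisym_det -det_tr.
by apply: determinant_alternate ij _ => k; rewrite !mxE eij.
Qed.

Lemma zconst_sign (b : bool) : zconst l ((-1) ^+ b : F) = (-1) ^+ b.
Proof.
by case: b; rewrite /zconst ?expr0 ?expr1 ?mpolyCN ?tofracN ?mpolyC1 ?tofrac1.
Qed.

Lemma has_coeffs_antisym e : has_coeffs (antisym e) (antisym_coeff e).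
Proof.
apply: has_coeffs_sum => s; rewrite -zconst_sign.
exact/has_coeffsZ/has_coeffs_zmon.
Qed.

(** A strictly decreasing sequence is the only one in its S_l-orbit and has a
    trivial stabilizer, so z^(la'+rho) occurs in the alternant of la + rho only
    if la = la', and then for the identity permutation alone. *)
Lemma antisym_coeff_shifted la la' :
  antisym_coeff (shifted la) (shifted la') = (la == la')%:R.
Proof.
have incr (s : 'S_l) : [tuple tnth (shifted la) (s i) | i < l] = shifted la' ->
    la = la' /\ s = 1%g.
  move=> eq_s.
  have eq_la : shifted la = shifted la'.
    apply/val_inj/(sorted_eq ge_trans ge_anti).
    - by apply: tuple_sorted_ge => i j /(shifted_decr la)/ltW.
    - by apply: tuple_sorted_ge => i j /(shifted_decr la')/ltW.
    - by rewrite -eq_s perm_sym perm_mktuple.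
  split; first exact: shifted_inj.
  apply/permP => i; rewrite perm1.
  have := congr1 (fun t => tnth t i) eq_s; rewrite tnth_mktuple -eq_la.
  by case: (ltngtP (s i) i) =>
    [/(shifted_decr la)|/(shifted_decr la)|/val_inj//] + eqi; rewrite eqi ltxx.
rewrite /antisym_coeff (bigD1 1%g) //= big1 => [|s s1]; last first.
  case: eqP => [/incr[_ /eqP]|_]; last by rewrite mulr0.
  by rewrite (negbTE s1).
rewrite odd_perm1 expr0 mul1r addr0; congr ((nat_of_bool _)%:R).
apply/eqP/eqP => [/incr[]//|->].
by apply: eq_from_tnth => i; rewrite tnth_mktuple perm1.
Qed.

(** The entries of rho are distinct, so z^rho appears in a_rho with
    coefficient 1, from the identity permutation only. *)
Lemma antisym_rho_neq0 : antisym (rho l) != 0.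
Proof.
apply/eqP => rho0; have := has_coeffs_antisym (rho l).
rewrite rho0 => /has_coeffs_unique/(_ (has_coeffs0 F l) (rho l)).
rewrite /antisym_coeff (bigD1 1%g) //= odd_perm1 expr0 mul1r.
have -> : [tuple tnth (rho l) ((1 : 'S_l)%g i) | i < l] = rho l.
  by apply: eq_from_tnth => i; rewrite tnth_mktuple perm1.
rewrite eqxx big1 ?addr0 => [/eqP|s s1]; first by rewrite oner_eq0.
suff /negbTE-> : [tuple tnth (rho l) (s i) | i < l] != rho l by rewrite mulr0.
apply: contraNneq s1 => smrho; apply/eqP/permP => i; rewrite perm1.
have := congr1 (fun t => tnth t i) smrho; rewrite !tnth_mktuple => h.
by apply: val_inj => /=; lia.
Qed.

(** * The inverse Kostka matrix *)

Lemma monomial_symE mu : monomial_sym F mu = \sum_(a <- rearr mu) zmon F a.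
Proof.
have -> : monomial_sym F mu =
    \sum_(a <- pmap insub (permutations mu) : seq (l.-tuple int)) zmon F a.
  rewrite /monomial_sym.
  have valK : [seq val a | a <- pmap insub (permutations mu)
                            : seq (l.-tuple int)] = permutations mu.
    rewrite (pmap_filter (insubK _)); apply/all_filterP/allP => a.
    rewrite mem_permutations => /perm_size; rewrite size_tuple => /eqP sz.
    by rewrite isSome_insub.
  rewrite -[in LHS]valK big_map; apply: eq_bigr => a _.
  by apply: eq_bigr => i _; rewrite (tnth_nth 0).
apply/perm_big/uniq_perm; rewrite ?fset_uniq ?pmap_sub_uniq ?permutations_uniq //.
by move=> a; rewrite inE.
Qed.

(** Summing z^(a + s(rho)) over the orbit of mu, a may be replaced by s(a) for
    each fixed s; exchanging the sums then collects alternants. *)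
Lemma monomial_sym_antisym mu :
  monomial_sym F mu * antisym (rho l) = \sum_(a <- rearr mu) antisym (shifted a).
Proof.
rewrite /antisym exchange_big mulr_sumr; apply: eq_bigr => s _ /=.
rewrite mulrCA -mulr_sumr; congr (_ * _).
rewrite monomial_symE -(perm_big _ (rearr_perm mu s)) big_map mulr_suml.
apply: eq_bigr => a _; rewrite -zmonD; congr (zmon _ _).
by apply: eq_from_tnth => i; rewrite !tnth_mktuple.
Qed.

(** A repeated exponent makes the alternant vanish; distinct exponents can be
    sorted into a strictly decreasing sequence, at the cost of a sign, and such
    a sequence is la + rho for some la. *)
Lemma antisym_straighten e : exists p : F * genpart l,
  antisym e = zconst l p.1 * antisym (shifted p.2).
Proof.
case: (boolP (uniq e)) => [uniq_e|]; last first.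
  move/(uniqPn 0) => [i [j [ij]]]; rewrite size_tuple => ltj eqij.
  exists (0, genpart_of e); rewrite /= [zconst l 0]/zconst mpolyC0 tofrac0 mul0r.
  apply: (@antisym_repeat _ (Ordinal (ltn_trans ij ltj)) (Ordinal ltj)).
    by rewrite -val_eqE /= ltn_eqF.
  by rewrite !(tnth_nth 0).
have /tuple_permP[s eq_s] : perm_eq (genpart_of e) e by rewrite perm_sort.
have tE i : tnth (genpart_of e) i = tnth e (s i).
  by rewrite (tnth_nth 0) eq_s -tnth_nth tnth_mktuple.
have decr (i j : 'I_l) : (i < j)%N -> tnth e (s j) < tnth e (s i).
  move=> ij; rewrite lt_neqAle -!tE genpart_anti 1?ltnW // andbT !tE.
  apply/eqP => /(tuple_uniqP _ uniq_e)/perm_inj ji.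
  by rewrite ji ltnn in ij.
(* Integers that decrease strictly lose at least 1 at each step, which is what
   subtracting rho uses up. *)
have gap (n : nat) (i j : 'I_l) : (j = i + n :> nat)%N ->
    tnth e (s j) + n%:Z <= tnth e (s i).
  elim: n j => [|n IHn] j ji.
    by rewrite addr0; have -> : i = j by apply: val_inj => /=; lia.
  have ltj : (i + n < l)%N by have := ltn_ord j; lia.
  have := IHn (Ordinal ltj) erefl.
  have := decr (Ordinal ltj) j; rewrite /= ji => /(_ _)/=; lia.
pose b := [tuple tnth e (s i) + i%:Z | i < l].
have b_sorted : sorted >=%R b.
  apply: tuple_sorted_ge => i j ij; rewrite !tnth_mktuple.
  by have := gap (j - i)%N i j; lia.
exists ((-1) ^+ s, GenPart b_sorted) => /=.
have -> : shifted b = [tuple tnth e (s i) | i < l].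
  by apply: eq_from_tnth => i; rewrite !tnth_mktuple addrK.
by rewrite zconst_sign antisym_perm mulrA -signr_addb addbb mul1r.
Qed.

(** Multiplication by a_rho turns Schur polynomials into single alternants. *)
Lemma schur_expansion_antisym mu (c : {fsfun genpart l -> F with 0}) :
  schur_expansion mu c <->
  monomial_sym F mu * antisym (rho l) =
    \sum_(la <- finsupp c) zconst l (c la) * antisym (shifted la).
Proof.
have -> : \sum_(la <- finsupp c) zconst l (c la) * antisym (shifted la) =
    (\sum_(la <- finsupp c) zconst l (c la) * schur F la) * antisym (rho l).
  rewrite mulr_suml; apply: eq_bigr => la _.
  by rewrite schur_antisym mulrA divfK ?antisym_rho_neq0.
by split=> [->//|/(mulIf antisym_rho_neq0)].
Qed.

(** By choice of a straightening for each a in the orbit of mu, collecting the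
    terms that straighten to the same la.  It is this existence that makes
    [inv_kostka] satisfy its defining equation. *)
Lemma schur_expansion_exists mu :
  exists c : {fsfun genpart l -> F with 0}, schur_expansion mu c.
Proof.
have [st stE] := choice antisym_straighten.
pose h a := (st (shifted a)).2.
pose S := [fset h a | a in rearr mu]%fset.
pose k la := \sum_(a <- rearr mu | h a == la) (st (shifted a)).1.
exists [fsfun la in S => k la]; apply/schur_expansion_antisym.
rewrite (big_fset_incl _ (finsupp_sub _ _ _)) => [|la _]; last first.
  by move=> /fsfun_dflt->; rewrite /zconst mpolyC0 tofrac0 mul0r.
rewrite monomial_sym_antisym (partition_big_imfset _ h) -/S.
apply: eq_big_seq => la laS; rewrite fsfun_fun laS /zconst !rmorph_sum mulr_suml.
by apply: eq_bigr => a /eqP <-; rewrite stE.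
Qed.

(** Comparison of the coefficients of z^(la+rho) in the two expansions of
    m_mu a_rho.  In the sum of the K^(-1)_(mu,la') a_(la'+rho) only la' = la
    contributes; in the sum of the a_(a+rho) over the orbit of mu, a permutation
    s contributes sgn(s) when s(a) = la + rho - s(rho) for some a, which is then
    unique. *)
Lemma inv_kostkaE mu la :
  inv_kostka F mu la =
  \sum_(s : 'S_l) (-1) ^+ s * (genpart_of (rho_twist la s) == mu)%:R.
Proof.
rewrite /inv_kostka; set c := xget _ _.
have : schur_expansion mu c by apply: xgetPex; apply: schur_expansion_exists.
move/schur_expansion_antisym; rewrite monomial_sym_antisym => eq_c.
have coef_l : has_coeffs (\sum_(a <- rearr mu) antisym (shifted a))
    (fun e => \sum_(a <- rearr mu) antisym_coeff (shifted a) e).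
  by apply: has_coeffs_sum => a; apply: has_coeffs_antisym.
have coef_r : has_coeffs
    (\sum_(la <- finsupp c) zconst l (c la) * antisym (shifted la))
    (fun e => \sum_(la <- finsupp c) c la * antisym_coeff (shifted la) e).
  by apply: has_coeffs_sum => a; apply/has_coeffsZ/has_coeffs_antisym.
rewrite eq_c in coef_l; have := has_coeffs_unique coef_l coef_r (shifted la).
have -> : \sum_(la' <- finsupp c)
    c la' * antisym_coeff (shifted la') (shifted la) = c la.
  under eq_bigr do rewrite antisym_coeff_shifted.
  case: (finsuppP c la) => [laN|la_in].
    rewrite big1_seq // => la' /= la'_in.
    case: eqP => [eq_la|_]; last by rewrite mulr0.
    by rewrite -eq_la la'_in in laN.
  rewrite (bigD1_seq la) ?fset_uniq //= eqxx mulr1 big1 ?addr0 // => la' ne_la.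
  by rewrite (negbTE ne_la) mulr0.
move=> <-; rewrite exchange_big; apply: eq_bigr => s _ /=.
rewrite -mulr_sumr; congr (_ * _).
transitivity (\sum_(a <- rearr mu) (a == rho_twist la s)%:R : F).
  rewrite -[RHS](perm_big _ (rearr_perm mu s)) big_map; apply: eq_bigr => a _.
  congr ((nat_of_bool _)%:R); apply/eqP/eqP => eq_a; apply: eq_from_tnth => i;
    have := congr1 (fun t => tnth t i) eq_a; rewrite !tnth_mktuple; lia.
rewrite genpart_of_eq -mem_rearr; case: (boolP (_ \in _)) => in_mu.
  rewrite (bigD1_seq (rho_twist la s)) ?fset_uniq //= eqxx.
  by rewrite big1 ?addr0 // => a /negbTE->.
rewrite big1_seq // => a /= a_in; case: eqP => // eq_a.
by rewrite -eq_a a_in in in_mu.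
Qed.

End Alternants.

(** * Alternating sums of Gaussian powers *)

(** Since x^((u_i + j)^2) = x^(u_i^2) (x^(2 u_i))^j x^(j^2), the matrix of the
    x^((u_i + j)^2) is, up to diagonal factors, the Vandermonde matrix of the
    x^(2 u_i). *)
Lemma gauss_alternating_sum (K : fieldType) (x : K) (l : nat) (u : 'I_l -> int) :
  x != 0 ->
  \sum_(s : 'S_l) (-1) ^+ s * \prod_(i < l) x ^ ((u i + (s i)%:Z) ^+ 2) =
  \prod_(i < l) x ^ ((u i + i%:Z) ^+ 2) *
  \prod_(i < l) \prod_(j < l | (i < j)%N) (1 - x ^ ((u i - u j) *+ 2)).
Proof.
move=> x0; pose b : 'rV[K]_l := \row_i x ^ (u i *+ 2).
transitivity (\prod_(i < l) (x ^ (u i ^+ 2) * x ^ (i%:Z ^+ 2)) *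
              \det (Vandermonde l b)).
  (* The inverse of s is used on the left, since the entries of the Vandermonde
     matrix have the node index as column index. *)
  rewrite /determinant mulr_sumr (reindex_inj invg_inj); apply: eq_bigr => s _ /=.
  rewrite odd_permV mulrCA; congr (_ * _).
  rewrite big_split /= [X in _ = _ * X * _](reindex_inj (@perm_inj _ s^-1%g)).
  rewrite [X in _ = _ * X](reindex_inj (@perm_inj _ s^-1%g)) -!big_split.
  apply: eq_bigr => i _ /=; rewrite !mxE permKV [X in _ = _ * X]exprnP.
  rewrite exprz_exp -!expfzDr //.
  by congr (_ ^ _); ring.
rewrite det_Vandermonde.
have -> : \prod_(i < l) \prod_(j < l | (i < j)%N) (b 0 j - b 0 i) =
    \prod_(i < l) x ^ (u i *+ 2 * i%:Z) *
    \prod_(i < l) \prod_(j < l | (i < j)%N) (1 - x ^ ((u i - u j) *+ 2)).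
  transitivity (\prod_(i < l) \prod_(j < l | (i < j)%N)
      (x ^ (u j *+ 2) * (1 - x ^ ((u i - u j) *+ 2)))).
    apply: eq_bigr => i _; apply: eq_bigr => j _.
    by rewrite !mxE mulrBr mulr1 -expfzDr //; congr (_ - _ ^ _); ring.
  under eq_bigr do rewrite big_split.
  rewrite big_split; congr (_ * _).
  rewrite (exchange_big_dep xpredT) //=; apply: eq_bigr => j _.
  rewrite (big_ord_narrow (ltnW (ltn_ord j))) prodr_const card_ord.
  by rewrite -exprz_exp.
rewrite mulrA -big_split; congr (_ * _); apply: eq_bigr => i _ /=.
by rewrite -!expfzDr //; congr (_ ^ _); ring.
Qed.

(** The case u = la + rho with x the square root of q; for i < j, u_i - u_j is
    the positive number la_i - la_j + j - i.  The computation takes place in the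
    fraction field because the nodes x^(2 u_i) may be negative powers. *)
Lemma gauss_alternating_poly (F : fieldType) (l : nat) (la : genpart l) :
  \sum_(s : 'S_l) (-1) ^+ s * sqrtq F ^+ gpsqr (genpart_of (rho_twist la s)) =
  sqrtq F ^+ gpsqr la *
    \prod_(i < l) \prod_(j < l | (i < j)%N)
      (1 - q F ^+ `|(tnth la i - tnth la j + j%:Z - i%:Z)%R|%N).
Proof.
apply/eqP; rewrite -tofrac_eq; apply/eqP.
set x := tofrac (sqrtq F).
have x0 : x != 0 by rewrite tofrac_eq0 polyX_eq0.
have sqrX (n : int) : x ^+ (`|n|%N ^ 2) = x ^ (n ^+ 2).
  by rewrite exprnP; congr (_ ^ _); rewrite -abszX gez0_abs ?sqr_ge0.
have sizeX (mu : genpart l) :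
    tofrac (sqrtq F ^+ gpsqr mu) = \prod_(i < l) x ^ (tnth mu i ^+ 2).
  rewrite rmorphXn -prodrXr; apply: eq_bigr => i _; exact: sqrX.
rewrite rmorph_sum rmorphM /= sizeX.
transitivity (\sum_(s : 'S_l) (-1) ^+ s *
    \prod_(i < l) x ^ (((tnth la i - i%:Z) + (s i)%:Z) ^+ 2)).
  apply: eq_bigr => s _; rewrite rmorphM rmorph_sign /= sizeX.
  rewrite (big_genpart_of _ _ (fun n => x ^ (n ^+ 2))); congr (_ * _).
  by apply: eq_bigr => i _; rewrite tnth_mktuple.
rewrite gauss_alternating_sum //; congr (_ * _).
  by apply: eq_bigr => i _; rewrite subrK.
rewrite rmorph_prod; apply: eq_bigr => i _.
rewrite rmorph_prod; apply: eq_bigr => j ij.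
rewrite rmorphB rmorph1 /q -exprM rmorphXn /= -/x; congr (_ - _).
rewrite [RHS]exprnP; congr (_ ^ _).
by have := genpart_anti la (ltnW ij); lia.
Qed.

Theorem corollary4p1 (R : realType) (l : nat) (l_gt0 : (0 < l)%N)
    (la : genpart l) :
  \sum_(mu \in [set mu : genpart l | gpsize mu = gpsize la]%classic)
     inv_kostka R[i] mu la *: sqrtq R[i] ^+ gpsqr mu
  = sqrtq R[i] ^+ gpsqr la *
    \prod_(i < l) \prod_(j < l | (i < j)%N)
      (1 - q R[i] ^+ `|(tnth la i - tnth la j + j%:Z - i%:Z)%R|%N).
Proof.
rewrite -gauss_alternating_poly.
(* The finitely many mu to which some permutation contributes. *)
pose r := undup [seq genpart_of (rho_twist la s) | s : 'S_l].
have r_size mu : mu \in r -> gpsize mu = gpsize la.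
  rewrite mem_undup => /codomP[s ->]; rewrite /gpsize (big_genpart_of _ _ id).
  under eq_bigr do rewrite tnth_mktuple.
  rewrite big_split sumrB /= [X in _ + X](_ : _ = \sum_(i < l) i%:Z) ?subrK //.
  by rewrite [RHS](reindex_inj (@perm_inj _ s)).
rewrite (fsbigE r) ?undup_uniq //; last first.
  move=> mu _ mu_r; rewrite inv_kostkaE big1 ?scale0r // => s _.
  case: eqP => [eq_mu|_]; last by rewrite mulr0.
  by rewrite -eq_mu mem_undup codom_f in mu_r.
rewrite big_seq_cond (eq_bigl (fun mu => mu \in r)) -?big_seq; last first.
  by move=> mu; case: (boolP (mu \in r)) => // mu_r; rewrite mem_set //= r_size.
under eq_bigr do rewrite inv_kostkaE scaler_suml.
rewrite exchange_big; apply: eq_bigr => s _ /=.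
rewrite (bigD1_seq (genpart_of (rho_twist la s))) ?undup_uniq //=; last first.
  by rewrite mem_undup codom_f.
rewrite eqxx mulr1 big1 ?addr0 => [|mu ne_mu].
  by rewrite -mul_polyC rmorph_sign.
by rewrite eq_sym (negbTE ne_mu) mulr0 scale0r.
Qed.
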